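(* Let $n\ge1$ and let $f:\mathbb R^n\to\mathbb R$ be the sum of a multilinear function and a continuously differentiable additively separable function. Then the Aumann-Shapley and Shapley-Shubik attribution methods agree for $f$: for all $r,s\in\mathbb R^n$ and all $i\in\{1,\dots,n\}$, $z_i^{AS}(r,s,f)=z_i^{SS}(r,s,f)$.
   Context: A function $f:\mathbb R^n\to\mathbb R$ is multilinear if $f(x)=\sum_{I\subseteq\{1,\dots,n\}} c_I\prod_{i\in I}x_i$ for some real constants $c_I$. It is additively separable if $f(x)=f_1(x_1)+\cdots+f_n(x_n)$ for some functions $f_i:\mathbb R\to\mathbb R$. The Aumann-Shapley method is $z_i^{AS}(r,s,f)=(s_i-r_i)\int_0^1\partial_i f(r+t(s-r))\,dt$. The Shapley-Shubik method is the average over all $\sigma\in S_n$ of the attributions obtained by changing the variables one at a time from $r_j$ to $s_j$ in the order given by $\sigma$ (variable $j$ is the $\sigma(j)$-th to change): $z_i^{SS}(r,s,f)=\frac1{n!}\sum_{\sigma\in S_n}\big[f(u^{\{j:\sigma(j)\le\sigma(i)\}})-f(u^{\{j:\sigma(j)<\sigma(i)\}})\big]$, where for $I\subseteq\{1,\dots,n\}$ the point $u^I\in\mathbb R^n$ has coordinates $u^I_j=s_j$ for $j\in I$ and $u^I_j=r_j$ for $j\notin I$. *)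

(* Defs.v *)
From mathcomp Require Import all_boot all_order all_algebra all_fingroup.
From mathcomp Require Import all_classical all_reals all_analysis.

Set Implicit Arguments.
Unset Strict Implicit.
Unset Printing Implicit Defensive.

Import Order.TTheory GRing.Theory Num.Theory.
Import numFieldNormedType.Exports.

Local Open Scope ring_scope.

Definition multilinear (R : realType) (n : nat) (f : 'rV[R]_n -> R) : Prop :=
  exists c : {set 'I_n} -> R,
    forall x, f x = \sum_(I : {set 'I_n}) c I * \prod_(i in I) x 0 i.

(* No regularity is required of the summands f_ i. *)
Definition additively_separable (R : realType) (n : nat)
    (f : 'rV[R]_n -> R) : Prop :=
  exists f_ : 'I_n -> R -> R, forall x, f x = \sum_(i < n) f_ i (x 0 i).

Definition partial_derivative (R : realType) (n : nat) (i : 'I_n)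
    (f : 'rV[R]_n -> R) (x : 'rV[R]_n) : R :=
  'D_(delta_mx 0 i) f x.

(* Since 'D_v f x is a total operator, existence of the partial derivatives
   has to be required separately from their continuity. *)
Definition continuously_differentiable (R : realType) (n : nat)
    (f : 'rV[R]_n -> R) : Prop :=
  forall i : 'I_n,
    (forall x, derivable f x (delta_mx 0 i)) /\
    continuous (partial_derivative i f).

Definition aumann_shapley (R : realType) (n : nat) (r s : 'rV[R]_n)
    (f : 'rV[R]_n -> R) (i : 'I_n) : R :=
  (s 0 i - r 0 i) *
  (\int[lebesgue_measure]_(t in `[0%R, 1%R])
     partial_derivative i f (r + t *: (s - r)))%R.

Definition mixed_point (R : realType) (n : nat) (r s : 'rV[R]_n)
    (I : {set 'I_n}) : 'rV[R]_n :=
  \row_(j < n) (if j \in I then s 0 j else r 0 j).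

Definition shapley_shubik (R : realType) (n : nat) (r s : 'rV[R]_n)
    (f : 'rV[R]_n -> R) (i : 'I_n) : R :=
  (n`!%:R)^-1 *
  \sum_(sigma : 'S_n)
    (f (mixed_point r s [set j : 'I_n | (sigma j <= sigma i)%N]%SET) -
     f (mixed_point r s [set j : 'I_n | (sigma j < sigma i)%N]%SET)).

(* Main.v *)
(* For a set K of coordinates not containing i, the number of orders in which
   exactly the elements of K precede i is #|K|! (n - 1 - #|K|)!, while
   \int_0^1 t^#|K| (1 - t)^(n - 1 - #|K|) dt = #|K|! (n - 1 - #|K|)! / n!.
   The derivative of a multilinear g along the i-th coordinate does not depend
   on that coordinate and is affine in each of the others, so on the segment
   from r to s it is the combination, with weights
   t^#|K| (1 - t)^(n - 1 - #|K|), of its values at the mixed points u^K; these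
   values times s_i - r_i are the increments of g averaged by the
   Shapley-Shubik method. For a separable function both attributions are
   h_i(s_i) - h_i(r_i), by the fundamental theorem of calculus. *)

Require Import Defs.
From mathcomp Require Import all_boot all_order all_algebra all_fingroup.
From mathcomp Require Import all_classical all_reals all_analysis.
From mathcomp Require Import ring.

Import Order.TTheory GRing.Theory Num.Theory.
Import numFieldNormedType.Exports.

Set Implicit Arguments.
Unset Strict Implicit.
Unset Printing Implicit Defensive.

Local Open Scope ring_scope.
Local Open Scope nat_scope.

(** * Counting the orders with a prescribed set of predecessors of [i] *)

Definition predecessors (n : nat) (sigma : 'S_n) (i : 'I_n) : {set 'I_n} :=
  [set j : 'I_n | sigma j < sigma i]%SET.

Lemma card_predecessors n (sigma : 'S_n) i : #|predecessors sigma i| = sigma i.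
Proof.
rewrite -(card_imset _ (@perm_inj _ sigma)).
have -> : sigma @: predecessors sigma i = [set k : 'I_n | k < sigma i]%SET.
  apply/setP => k; rewrite inE; apply/imsetP/idP => [[j]|ki].
    by rewrite inE => ji ->.
  by exists ((sigma^-1)%g k); rewrite ?inE permKV.
rewrite cardsE -sum1_card -(big_ord_widen n (fun=> 1)) ?sum1_card ?card_ord//.
exact: ltnW.
Qed.

Lemma predecessors_notin n (sigma : 'S_n) i : i \notin predecessors sigma i.
Proof. by rewrite inE ltnn. Qed.

(** List [K], then [i], then the remaining indices; the order sends each index to its position in
    this list. *)
Lemma ex_perm_predecessors n (i : 'I_n) (K : {set 'I_n}) : i \notin K ->
  exists sigma : 'S_n, predecessors sigma i = K.
Proof.
move=> iNK; pose s := enum K ++ i :: enum (~: (i |: K))%SET.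
have s_all j : j \in s.
  by rewrite mem_cat mem_enum inE mem_enum !inE; case: (j \in K); case: eqP.
have size_s : size s = n.
  rewrite size_cat /= -!cardE addnS -addSn.
  by have := cardsC (i |: K)%SET; rewrite cardsU1 iNK card_ord add1n.
have idx j : index j s < n by rewrite -[X in _ < X]size_s index_mem.
have idx_inj : injective (fun j => Ordinal (idx j)).
  move=> j k /(congr1 val)/= jk.
  by rewrite -(nth_index i (s_all j)) jk nth_index.
exists (perm idx_inj); apply/setP => j; rewrite inE !permE /= !index_cat.
rewrite !mem_enum (negPf iNK) /= eqxx addn0.
case: ifPn => jK; last by rewrite -cardE ltnNge leq_addr.
by rewrite [LHS]index_mem mem_enum.
Qed.

(** Composing with a transposition of two ranks maps one class bijectively onto the other, so the
    [n] classes share the total [n!] equally. *)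
Lemma card_perm_image n (i k : 'I_n) :
  #|[set sigma : 'S_n | sigma i == k]%SET| = n.-1`!.
Proof.
have same l : #|[set sigma : 'S_n | sigma i == l]%SET| =
              #|[set sigma : 'S_n | sigma i == k]%SET|.
  rewrite -(card_imset _ (@mulIg _ (tperm k l))); congr #|pred_of_set _|.
  apply/setP => sigma; rewrite inE; apply/imsetP/eqP => [[tau]|sk].
    by rewrite inE => /eqP tl ->; rewrite permM tl tpermR.
  exists (sigma * tperm k l)%g; first by rewrite inE permM sk tpermL.
  by rewrite -mulgA tperm2 mulg1.
have : \sum_(l < n) #|[set sigma : 'S_n | sigma i == l]%SET| = n`!.
  rewrite -(card_Sn n) -sum1_card.
  rewrite (partition_big (fun sigma : 'S_n => sigma i) xpredT)//=.
  by apply: eq_bigr => l _; rewrite -sum1dep_card.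
under eq_bigr do rewrite same.
rewrite sum_nat_const card_ord; case: n i k {same} => [[]//|m] i k.
by rewrite factS => /eqP; rewrite eqn_pmul2l// => /eqP.
Qed.

(** If [alpha] and [beta] realise [K] and [L], then [beta * alpha^-1] fixes [i] and carries [L] onto
    [K]; multiplying by it on the left is a bijection between the two classes. *)
Lemma card_perm_predecessors_eq n (i : 'I_n) (K L : {set 'I_n}) :
    i \notin K -> i \notin L -> #|K| = #|L| ->
  #|[set sigma : 'S_n | predecessors sigma i == K]%SET| =
  #|[set sigma : 'S_n | predecessors sigma i == L]%SET|.
Proof.
move=> /ex_perm_predecessors[alpha aK] /ex_perm_predecessors[beta bL] KL.
have ab : alpha i = beta i.
  by apply: val_inj; rewrite /= -!card_predecessors aK bL.
rewrite -(card_imset _ (@mulgI _ (beta * alpha^-1)%g)).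
have tauE (sigma : 'S_n) : predecessors (beta * alpha^-1 * sigma)%g i =
    ((beta * alpha^-1)%g @^-1: predecessors sigma i)%SET.
  by apply/setP => j; rewrite !inE !permM -[beta i]ab permK.
have KLtau : ((beta * alpha^-1)%g @^-1: K)%SET = L.
  by apply/setP => j; rewrite -aK -bL !inE permM permKV ab.
congr #|pred_of_set _|; apply/setP => sigma; rewrite inE.
apply/imsetP/eqP => [[tau]|sL].
  by rewrite inE => /eqP tK ->; rewrite tauE tK KLtau.
exists ((beta * alpha^-1)^-1 * sigma)%g; last by rewrite mulKVg.
rewrite inE; apply/eqP/setP => j.
move/setP: sL => /(_ ((beta * alpha^-1)^-1 j)%g).
by rewrite -KLtau -{1}(mulKVg (beta * alpha^-1)%g sigma) tauE !inE permKV.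
Qed.

(* By symmetry the count depends only on the cardinality of K, so it is the
   number (n-1)! of orders in which i has rank #|K|, divided by the number
   'C(n-1, #|K|) of candidate sets of that cardinality. *)
Lemma card_perm_predecessors n (i : 'I_n) (K : {set 'I_n}) : i \notin K ->
  #|[set sigma : 'S_n | predecessors sigma i == K]%SET| =
  (#|K|)`! * (n.-1 - #|K|)`!.
Proof.
move=> iNK; have [alpha aK] := ex_perm_predecessors iNK.
have cardCi : #|[set~ i]%SET| = n.-1 by rewrite cardsC1 card_ord.
have Kn : #|K| <= n.-1.
  rewrite -cardCi subset_leq_card//; apply/fintype.subsetP => j jK; rewrite !inE.
  by apply: contraNneq iNK => <-.
(* Here [alpha i] equals [#|K|], so these orders split according to predecessor sets of that
   cardinality. *)
have := card_perm_image i (alpha i).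
rewrite -sum1dep_card.
rewrite (partition_big (fun sigma => predecessors sigma i)
  [pred L : {set 'I_n} | (L \subset [set~ i]%SET) && (#|L| == #|K|)])/=;
  last first.
  move=> sigma; rewrite card_predecessors => /eqP ->.
  rewrite -card_predecessors aK eqxx andbT; apply/fintype.subsetP => j.
  by rewrite !inE; apply: contraTneq => ->; rewrite ltnn.
rewrite (eq_bigr (fun=> #|[set sigma : 'S_n | predecessors sigma i == K]%SET|)).
  rewrite sum_nat_const -(cardsE (fun L => _)) cards_draws cardCi => cE.
  apply/eqP; rewrite -(@eqn_pmul2l 'C(n.-1, #|K|)) ?bin_gt0//; apply/eqP.
  by rewrite cE bin_fact.
move=> L /andP[Li /eqP LK].
rewrite (@card_perm_predecessors_eq _ i K L)//; last first.
  by apply/negP => /(fintype.subsetP Li); rewrite !inE eqxx.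
rewrite sum1dep_card; congr #|pred_of_set _|; apply/setP => sigma; rewrite !inE.
apply: andb_idl => /eqP sL; apply/eqP/val_inj.
by rewrite /= -!card_predecessors sL aK.
Qed.

Local Close Scope nat_scope.

(** Used forwards to regroup the Shapley-Shubik average, and backwards with [F] constant to see that
    the weights add up to [n!]. *)
Lemma sum_perm_predecessors (V : nmodType) n (i : 'I_n) (F : {set 'I_n} -> V) :
  \sum_(sigma : 'S_n) F (predecessors sigma i) =
  \sum_(K : {set 'I_n} | i \notin K) F K *+ ((#|K|)`! * (n.-1 - #|K|)`!).
Proof.
rewrite (partition_big (fun sigma => predecessors sigma i)
  [pred K : {set 'I_n} | i \notin K])/=; last first.
  by move=> sigma _; exact: predecessors_notin.
apply: eq_bigr => K iNK; rewrite -(card_perm_predecessors iNK) -sumr_const.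
by apply: congr_big => // [sigma|sigma /eqP ->//]; rewrite inE.
Qed.

(** * Increments at mixed points and multilinear slopes along a segment *)

Section SegmentExpansion.
Variables (R : realType) (n : nat).
Implicit Types (i : 'I_n) (x r s : 'rV[R]_n) (K : {set 'I_n}).

Lemma mixed_pointU1 r s i K : i \notin K ->
  mixed_point r s (i |: K)%SET =
  (s 0 i - r 0 i) *: delta_mx 0 i + mixed_point r s K.
Proof.
move=> iNK; apply/rowP => j; rewrite !mxE !inE eqxx /=.
by have [->|_] := eqVneq j i; rewrite ?(negPf iNK) ?mulr1 ?subrK// mulr0 add0r.
Qed.

Lemma shapley_shubikE r s (f : 'rV[R]_n -> R) i :
  shapley_shubik r s f i =
  (n`!%:R)^-1 * \sum_(K : {set 'I_n} | i \notin K)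
    (f (mixed_point r s (i |: K)%SET) - f (mixed_point r s K)) *+
    ((#|K|)`! * (n.-1 - #|K|)`!).
Proof.
rewrite -sum_perm_predecessors; congr (_ * _); apply: eq_bigr => sigma _.
congr (f (mixed_point r s _) - _); apply/setP => j.
by rewrite !inE leq_eqVlt (inj_eq val_inj) (inj_eq perm_inj).
Qed.

(** This is the [i]-th partial derivative in closed form; coordinate [i] no longer occurs in it. *)
Definition multilinear_slope (c : {set 'I_n} -> R) i x : R :=
  \sum_(I : {set 'I_n} | i \in I) c I * \prod_(j in I | j != i) x 0 j.

(** Exact for every [a], so it yields both the derivative along coordinate [i] and the finite
    increments between mixed points. *)
Lemma multilinear_line (c : {set 'I_n} -> R) (g : 'rV[R]_n -> R) i (a : R) x :
    (forall x, g x = \sum_(I : {set 'I_n}) c I * \prod_(j in I) x 0 j) ->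
  g (a *: delta_mx 0 i + x) = g x + a * multilinear_slope c i x.
Proof.
move=> gE; rewrite !gE /multilinear_slope mulr_sumr.
rewrite [X in _ = _ + X]big_mkcond -big_split /=; apply: eq_bigr => I _.
have other (P : pred 'I_n) : {in P, forall j, j != i} ->
    \prod_(j | P j) (a *: delta_mx 0 i + x) 0 j = \prod_(j | P j) x 0 j.
  by move=> Pi; apply: eq_bigr => j /Pi ji; rewrite !mxE (negPf ji) mulr0 add0r.
case: ifPn => iI; last first.
  rewrite addr0 other// => j jI; by apply: contraNneq iI => <-.
rewrite !(bigD1 i iI)/= other => [|j /andP[]//].
by rewrite !mxE !eqxx /= mulr1; ring.
Qed.

(* Each coordinate of the point is t * s + (1 - t) * r, so the product over
   all coordinates but i expands over the sets K of coordinates taken in s. *)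
Lemma multilinear_slope_segment (c : {set 'I_n} -> R) i r s (t : R) :
  multilinear_slope c i (r + t *: (s - r)) =
  \sum_(K : {set 'I_n} | i \notin K)
    XMonemX #|K| (n.-1 - #|K|) t * multilinear_slope c i (mixed_point r s K).
Proof.
under [RHS]eq_bigr do rewrite mulr_sumr.
rewrite exchange_big; apply: eq_bigr => I iI /=.
under [RHS]eq_bigr do rewrite mulrCA.
rewrite -mulr_sumr; congr (_ * _).
(* The factor [u j + v j] is the coordinate of the point for [j] in [I] other than [i], and 1 for
   every other [j]. Taking [u i = 0] kills the terms of the expansion with [i] in [K]. *)
pose u j := if j == i then 0 else t * (if j \in I then s 0 j else 1).
pose v j := if j == i then 1 else (1 - t) * (if j \in I then r 0 j else 1).
transitivity (\prod_j (u j + v j)).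
  rewrite [RHS](bigID (fun j => (j \in I) && (j != i)))/= [X in _ = _ * X]big1
      ?mulr1; last first.
    move=> j; rewrite /u /v negb_and negbK.
    case: eqP => [_ _|_]; rewrite ?add0r//.
    by rewrite orbF => /negPf ->; ring.
  by apply: eq_bigr => j /andP[jI /negPf ji]; rewrite /u /v ji jI !mxE; ring.
rewrite bigA_distr (bigID (fun K : {set 'I_n} => i \notin K))/=.
rewrite [X in _ + X]big1 ?addr0; last first.
  move=> K /negPn iK.
  by rewrite (bigD1 i)//= iK /u eqxx mul0r.
apply: eq_bigr => K iNK.
rewrite (bigD1 i)//= (negPf iNK) {1}/v eqxx mul1r.
rewrite [LHS](eq_bigr (fun j => (if j \in K then t else 1 - t) *
    (if j \in I then mixed_point r s K 0 j else 1))); last first.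
  by move=> j /negPf ji; rewrite /u /v ji mxE; do 2 case: ifP.
rewrite big_split/= -big_mkcondr/=; congr (_ * _); last first.
  by apply: eq_bigl => j; rewrite andbC.
rewrite (bigID (mem K))/=; congr (_ * _).
  rewrite -prodr_const; apply: congr_big => // j.
    by apply: andb_idl; apply: contraTneq => ->.
  by case/andP => _ ->.
(* The exponent of [1 - t] counts the indices outside [K] other than [i]. *)
have <- : #|([set~ i] :\: K)%SET|%N = (n.-1 - #|K|)%N.
  rewrite cardsD cardsC1 card_ord; congr (_ - #|pred_of_set _|)%N.
  apply/setP => j; rewrite !inE andb_idl//.
  by apply: contraTneq => ->.
rewrite -prodr_const; apply: congr_big => // j.
  by rewrite !inE andbC.
by case/andP => _ /negPf ->.
Qed.

End SegmentExpansion.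

(** * Derivatives and integrals in one real variable *)

Section Calculus.
Variable R : realType.
Notation mu := lebesgue_measure.

(** The difference quotient equals [c] for every nonzero increment. *)
Lemma is_derive_line (V W : normedModType R) (f : V -> W) (x v : V) (c : W) :
  (forall a : R, f (a *: v + x) = f x + a *: c) -> is_derive x v f c.
Proof.
move=> fE.
have cvg_c : ((fun a : R => a^-1 *: ((f \o shift x) (a *: v) - f x))
    @ (0:R)^' --> c)%classic.
  apply: (@cvg_trans _ (c @[_ --> (0:R)^']))%classic; last exact: cvg_cst.
  apply: near_eq_cvg; near=> a.
  have a0 : a != 0 by near: a; exact: nbhs_dnbhs_neq.
  by rewrite /= fE addrC addKr scalerA mulVf// scale1r.
by apply: DeriveDef; [apply/cvg_ex; exists c | exact: cvg_lim cvg_c].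
Unshelve. all: end_near. Qed.

Lemma Rintegral_sum (d : measure_display) (T : measurableType d)
    (m : {measure set T -> \bar R}) (D : set T) (I : Type) (l : seq I)
    (P : pred I) (F : I -> T -> R) : measurable D ->
    (forall k, P k -> m.-integrable D (EFin \o F k)) ->
  (\int[m]_(t in D) (\sum_(k <- l | P k) F k t) =
  \sum_(k <- l | P k) \int[m]_(t in D) F k t)%R.
Proof.
move=> mD iF; elim: l => [|k l IHl].
  under eq_Rintegral do rewrite big_nil.
  by rewrite Rintegral_cst// mul0r big_nil.
under eq_Rintegral do rewrite big_cons.
rewrite big_cons; case: ifPn => // Pk.
rewrite RintegralD ?IHl//; first exact: iF.
rewrite [X in integrable _ _ X](_ : _ = fun t =>
    (\sum_(j <- l | P j) (F j t)%:E)%E).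
  by apply: integrable_sum => // j; exact: iF.
by apply/funext => t /=; rewrite sumEFin.
Qed.

(** Euler's Beta integral [B(a+1, b+1)]. *)
Lemma Rintegral_XMonemX (a b : nat) :
  (\int[mu]_(t in `[0%R, 1%R]) XMonemX a b t =
   (a`! * b`!)%:R / (a + b).+1`!%:R :> R)%R.
Proof. by rewrite -beta_fun_fact /beta_fun -Rintegral_mkcond. Qed.

Lemma Rintegral01_derive (F f : R -> R) : continuous f ->
    (forall t : R, is_derive t 1 F (f t)) ->
  (\int[mu]_(t in `[0%R, 1%R]) f t = F 1 - F 0)%R.
Proof.
move=> cf dF.
(* Continuity supplies the one-sided limits at 0 and 1 required by the fundamental theorem of
   calculus. *)
have cF : continuous F.
  by move=> t; apply/differentiable_continuous/derivable1_diffP; case: (dF t).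
rewrite /Rintegral (@continuous_FTC2 R f F 0 1)//.
- exact: continuous_subspaceT.
- split=> [t _| |]; first by case: (dF t).
  + by apply: cvg_at_right_filter; exact: cF.
  + by apply: cvg_at_left_filter; exact: cF.
- by move=> t _; rewrite derive1E derive_val.
Qed.

Lemma integrable01_continuous (f : R -> R) : continuous f ->
  mu.-integrable `[0, 1]%classic (EFin \o f).
Proof.
move=> cf; apply: continuous_compact_integrable; first exact: segment_compact.
exact: continuous_subspaceT.
Qed.

End Calculus.

(** * Additivity of both methods and their agreement on each summand *)

Section AumannShapley.
Variables (R : realType) (n : nat).
Implicit Types (i : 'I_n) (r s x : 'rV[R]_n).

Lemma continuous_segment r s : continuous (fun t : R => r + t *: (s - r)).
Proof.
by move=> t; apply: cvgD; [exact: cvg_cst | apply: cvgZr_tmp; exact: cvg_id].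
Qed.

(** Moving along axis [i] leaves the other summands unchanged, so [h] and [h_ i] have the same
    difference quotients. *)
Lemma is_derive_summand (h : 'rV[R]_n -> R) (h_ : 'I_n -> R -> R) i x :
    (forall x, h x = \sum_(j < n) h_ j (x 0 j)) ->
    derivable h x (delta_mx 0 i) ->
  is_derive (x 0 i) 1 (h_ i) (partial_derivative i h x).
Proof.
move=> hE dh.
have quotE : (fun a : R =>
      a^-1 *: ((h_ i \o shift (x 0 i)) (a *: 1) - h_ i (x 0 i))) =
    (fun a : R => a^-1 *: ((h \o shift x) (a *: delta_mx 0 i) - h x)).
  apply/funext => a; congr (_ *: _).
  rewrite /= !hE (bigD1 i)//= [in X in _ = _ - X](bigD1 i)//= !mxE !eqxx /=.
  rewrite [X in _ = _ + X - _](eq_bigr (fun j => h_ j (x 0 j))); last first.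
    by move=> j /negPf ji; rewrite !mxE ji mulr0 add0r.
  by rewrite /GRing.scale/=; ring.
by apply: DeriveDef; rewrite /derivable /partial_derivative /derive quotE.
Qed.

(** Derivability makes the partial derivative additive; continuity makes both integrands integrable
    on the segment. *)
Lemma aumann_shapleyD r s (g h : 'rV[R]_n -> R) i :
    (forall x, derivable g x (delta_mx 0 i)) ->
    (forall x, derivable h x (delta_mx 0 i)) ->
    continuous (partial_derivative i g) ->
    continuous (partial_derivative i h) ->
  aumann_shapley r s (g \+ h) i =
  aumann_shapley r s g i + aumann_shapley r s h i.
Proof.
move=> dg dh cg ch; have csg := @continuous_segment r s.
rewrite /aumann_shapley -mulrDr -RintegralD//; last 2 first.
- by apply: integrable01_continuous => t;
     exact: (continuous_comp (csg t) (cg _)).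
- by apply: integrable01_continuous => t;
     exact: (continuous_comp (csg t) (ch _)).
by congr (_ * _); apply: eq_Rintegral => t _;
   rewrite /partial_derivative deriveD.
Qed.

Lemma shapley_shubikD r s (g h : 'rV[R]_n -> R) i :
  shapley_shubik r s (g \+ h) i =
  shapley_shubik r s g i + shapley_shubik r s h i.
Proof.
rewrite /shapley_shubik -mulrDr -big_split /=; congr (_ * _).
by apply: eq_bigr => sigma _; rewrite addrACA opprD.
Qed.

Lemma is_derive_multilinear (c : {set 'I_n} -> R) (g : 'rV[R]_n -> R) i x :
    (forall x, g x = \sum_(I : {set 'I_n}) c I * \prod_(j in I) x 0 j) ->
  is_derive x (delta_mx 0 i) g (multilinear_slope c i x).
Proof.
by move=> gE; apply: is_derive_line => a; rewrite (multilinear_line _ _ _ gE).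
Qed.

Lemma continuous_multilinear_slope (c : {set 'I_n} -> R) i :
  continuous (multilinear_slope c i).
Proof.
apply: continuous_big => [|I _ x]; first exact: add_continuous.
have prodC : continuous (fun y : 'rV[R]_n => \prod_(j in I | j != i) y 0 j).
  apply: (@continuous_big R _ *%R 1 (fun j => (j \in I) && (j != i))) => [|j _].
    exact: mul_continuous.
  exact: coord_continuous.
by apply: continuousM; [exact: cst_continuous | exact: prodC].
Qed.

Lemma aumann_shapley_multilinear r s (g : 'rV[R]_n -> R) i :
  multilinear g -> aumann_shapley r s g i = shapley_shubik r s g i.
Proof.
case=> c gE; rewrite shapley_shubikE /aumann_shapley.
under eq_Rintegral do rewrite /partial_derivative
  (derive_val (is_derive := is_derive_multilinear i _ gE))
  multilinear_slope_segment.
rewrite Rintegral_sum// => [|K _]; last first.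
  apply: integrable01_continuous => t; apply: continuousM.
    exact: continuous_XMonemX.
  exact: cst_continuous.
rewrite !mulr_sumr; apply: eq_bigr => K iNK.
rewrite RintegralZr//; last exact: integrable_XMonemX.
(* With this bound the truncated subtraction is exact, and the two exponents plus one add up to [n]:
   the Beta integral has denominator [n!]. *)
have Kn : (#|K| <= n.-1)%N.
  have [sigma <-] := ex_perm_predecessors iNK.
  rewrite card_predecessors.
  by case: (n) sigma i {iNK} => [_ []//|m] sigma i; rewrite -ltnS.
have n0 : (0 < n)%N by exact: leq_ltn_trans (ltn_ord i).
rewrite Rintegral_XMonemX subnKC// prednK//.
rewrite mixed_pointU1// (multilinear_line _ _ _ gE) -mulr_natl.
by ring.
Qed.

Lemma aumann_shapley_separable r s (h : 'rV[R]_n -> R) i :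
    additively_separable h -> continuously_differentiable h ->
  aumann_shapley r s h i = shapley_shubik r s h i.
Proof.
case=> h_ hE /(_ i)[dh ch].
(* The increment does not depend on which coordinates have changed before [i]. *)
have step (K : {set 'I_n}) : i \notin K ->
    h (mixed_point r s (i |: K)%SET) - h (mixed_point r s K) =
    h_ i (s 0 i) - h_ i (r 0 i).
  move=> iNK; rewrite !hE (bigD1 i)//= [in X in _ - X](bigD1 i)//=.
  rewrite !mxE setU11 (negPf iNK).
  rewrite [X in _ + X - _](eq_bigr (fun j => h_ j (mixed_point r s K 0 j))).
    by ring.
  by move=> j /negPf ji; rewrite !mxE in_setU1 ji.
transitivity (h_ i (s 0 i) - h_ i (r 0 i)).
  (* Once [s 0 i - r 0 i] is moved under the integral, the integrand is the derivative of [F]. *)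
  pose F t := h_ i (r 0 i + t * (s 0 i - r 0 i)).
  have cp : continuous (fun t : R => partial_derivative i h (r + t *: (s - r))).
    by move=> t; exact: (continuous_comp (@continuous_segment r s t) (ch _)).
  rewrite /aumann_shapley -RintegralZl//; last exact: integrable01_continuous.
  have dF (t : R) : is_derive t 1 F
      ((s 0 i - r 0 i) * partial_derivative i h (r + t *: (s - r))).
    have coordE : r 0 i + t * (s 0 i - r 0 i) = (r + t *: (s - r)) 0 i.
      by rewrite !mxE.
    rewrite mulrC.
    apply: (@is_derive1_comp R (h_ i) (fun t => r 0 i + t * (s 0 i - r 0 i))).
      by rewrite coordE; exact: is_derive_summand.
    by apply: is_derive_line => a; rewrite /GRing.scale/=; ring.
  rewrite (Rintegral01_derive _ dF).
    by rewrite /F mul1r mul0r addr0 subrKC.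
  move=> t. exact: (continuousM (@cst_continuous _ _ _ _) (cp t)).
rewrite shapley_shubikE (eq_bigr (fun K : {set 'I_n} =>
    (h_ i (s 0 i) - h_ i (r 0 i)) *+
    ((#|K|)`! * (n.-1 - #|K|)`!))); last by move=> K iNK; rewrite step.
(* The constant increment is summed over all [n!] orders, which cancels the normalisation. *)
rewrite -(sum_perm_predecessors i (fun=> _)) sumr_const card_Sn
  -(mulr_natl (_ - _)) mulKf// pnatr_eq0 -lt0n fact_gt0.
Qed.

End AumannShapley.

Unset Implicit Arguments.

Theorem theorem4p1 (R : realType) (n : nat) (hn : (1 <= n)%N)
    (f g h : 'rV[R]_n -> R)
    (hg : multilinear g)
    (hh_sep : additively_separable h)
    (hh_C1 : continuously_differentiable h)
    (hf : forall x : 'rV[R]_n, f x = g x + h x) :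
  forall (r s : 'rV[R]_n) (i : 'I_n),
    aumann_shapley r s f i = shapley_shubik r s f i.
Proof.
move=> r s i; have -> : f = g \+ h by exact/funext.
rewrite shapley_shubikD -aumann_shapley_multilinear//.
rewrite -aumann_shapley_separable//.
have [dh ch] := hh_C1 i; have [c gE] := hg.
(* The regularity of [g] needed for additivity comes from its explicit slope, a polynomial in the
   coordinates. *)
have dg x := is_derive_multilinear i x gE.
apply: aumann_shapleyD => //.
rewrite (_ : partial_derivative i g = multilinear_slope c i).
  exact: continuous_multilinear_slope.
by apply/funext => x; case: (dg x).
Qed.
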